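(* Let $\mathbf{\Psi}=(p_{ab})\in\mathbb{R}^{N\times K}$ with $N>K$ have full column rank, let $\mathcal{N}=\{1,\dots,N\}$ be its set of row indices, and let $L\ge K$ be an integer, the number of rows to be selected. Suppose that $\mathbf{\Psi}$ is a non-orthogonal matrix and that the elements of each row of $\mathbf{\Psi}$ have the same sign. Let $\mathcal{L}^*$ be an optimal solution of $$\min_{\mathcal{L}\subseteq\mathcal{N},\ |\mathcal{L}|=L}F(\mathcal{L}),\qquad F(\mathcal{L})=\mathrm{FP}(\mathbf{\Psi}(\mathcal{L})).$$ Then the set $\mathcal{L}'$ obtained from the Fast Frank-Wolfe Algorithm for Vector Signals is near optimal with respect to the frame potential: $$F(\mathcal{L}')\le\gamma F(\mathcal{L}^* ),\qquad \gamma=\frac{1}{N+L}\left(F(\mathcal{N})\frac{KL}{L_{\min}^2}+N\right),$$ where $L_{\min}=\min_{|\mathcal{L}|=L}\sum_{i\in\mathcal{L}}\|u_i\|_2^2$ and $u_i$ is the $i$-th row of $\mathbf{\Psi}$.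
   Context: For $\mathcal{L}\subseteq\mathcal{N}$, $\mathbf{\Psi}(\mathcal{L})$ is the submatrix of $\mathbf{\Psi}$ formed by the rows indexed by $\mathcal{L}$, $\mathbf{T}(\mathcal{L})=\mathbf{\Psi}(\mathcal{L})^T\mathbf{\Psi}(\mathcal{L})$, and the frame potential is $\mathrm{FP}(\mathbf{\Psi}(\mathcal{L})):=\operatorname{tr}\{\mathbf{T}(\mathcal{L})^T\mathbf{T}(\mathcal{L})\}$. Fast Frank-Wolfe Algorithm for Vector Signals. Input: $\mathbf{\Psi}=(p_{ab})\in\mathbb{R}^{N\times K}$ and $L$. With $\boldsymbol{p}_i$ the $i$-th column of $\mathbf{\Psi}$: (1) compute $m_{ij}=\boldsymbol{p}_i^T\boldsymbol{p}_j$ for $i,j=1,\dots,K$; (2) compute $d_n=\sum_{i=1}^K\sum_{j=1}^K m_{ij}p_{ni}p_{nj}$ for $n=1,\dots,N$; (3) select the $L$ elements $d_{l_1},\dots,d_{l_L}$ with the smallest values from $\{d_1,\dots,d_N\}$; (4) return $\mathcal{L}'=\{l_1,\dots,l_L\}$. *)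

(* Defs.v *)
From HB Require Import structures.
From mathcomp Require Import all_boot all_order all_algebra.
From mathcomp Require Import reals.

Set Implicit Arguments.
Unset Strict Implicit.
Unset Printing Implicit Defensive.

Import Order.TTheory GRing.Theory Num.Theory.
Local Open Scope ring_scope.

Definition row_submatrix (R : realType) (N K : nat) (Psi : 'M[R]_(N, K))
    (A : {set 'I_N}) : 'M[R]_(#|A|, K) :=
  rowsub (fun i : 'I_#|A| => enum_val i) Psi.

Definition frame_matrix (R : realType) (m K : nat) (M : 'M[R]_(m, K)) : 'M[R]_K :=
  M^T *m M.

Definition frame_potential (R : realType) (m K : nat) (M : 'M[R]_(m, K)) : R :=
  \tr ((frame_matrix M)^T *m frame_matrix M).

Definition F (R : realType) (N K : nat) (Psi : 'M[R]_(N, K)) (A : {set 'I_N}) : R :=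
  frame_potential (row_submatrix Psi A).

Definition is_optimal_selection (R : realType) (N K : nat) (Psi : 'M[R]_(N, K))
    (L : nat) (A : {set 'I_N}) : Prop :=
  #|A| = L /\ (forall B : {set 'I_N}, #|B| = L -> F Psi A <= F Psi B).

(* For a rectangular matrix, orthogonality is orthonormality of the columns. *)
Definition orthogonal_matrix (R : realType) (N K : nat) (Psi : 'M[R]_(N, K)) : Prop :=
  Psi^T *m Psi = 1%:M.

(* Zero entries are compatible with either sign. *)
Definition same_sign_rows (R : realType) (N K : nat) (Psi : 'M[R]_(N, K)) : Prop :=
  forall i : 'I_N, (forall j : 'I_K, 0 <= Psi i j) \/ (forall j : 'I_K, Psi i j <= 0).

Definition ffw_m (R : realType) (N K : nat) (Psi : 'M[R]_(N, K)) (i j : 'I_K) : R :=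
  ((col i Psi)^T *m col j Psi) 0 0.

Definition ffw_d (R : realType) (N K : nat) (Psi : 'M[R]_(N, K)) (n : 'I_N) : R :=
  \sum_(i < K) \sum_(j < K) ffw_m Psi i j * Psi n i * Psi n j.

(* The algorithm does not say how ties between equal [d_n] are broken, so its
   output is a relation: any [L] indices carrying the [L] smallest values. *)
Definition ffw_output (R : realType) (N K : nat) (Psi : 'M[R]_(N, K))
    (L : nat) (A : {set 'I_N}) : Prop :=
  #|A| = L /\
  (forall i j : 'I_N, i \in A -> j \notin A -> ffw_d Psi i <= ffw_d Psi j).

Definition norm2 (R : realType) (K : nat) (u : 'rV[R]_K) : R :=
  Num.sqrt (\sum_(j < K) u 0 j ^+ 2).

Definition row_energy (R : realType) (N K : nat) (Psi : 'M[R]_(N, K))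
    (A : {set 'I_N}) : R :=
  \sum_(i in A) norm2 (row i Psi) ^+ 2.

(* The initial value of the iterated minimum is the energy of all the rows; it
   bounds every term from above, so this is the minimum over the sets of
   cardinality [L] whenever [L <= N]. *)
Definition L_min (R : realType) (N K : nat) (Psi : 'M[R]_(N, K)) (L : nat) : R :=
  \big[Num.min/row_energy Psi [set: 'I_N]]_(A : {set 'I_N} | #|A| == L)
    row_energy Psi A.

(* If [L_min Psi L = 0] (at least [L] zero rows), the quotient below is [0] by
   the convention [x / 0 = 0]; the frame potentials of an optimal selection and
   of any [ffw_output] are then both [0]. *)
Definition gamma (R : realType) (N K : nat) (Psi : 'M[R]_(N, K)) (L : nat) : R :=
  1 / (N + L)%:R * (F Psi [set: 'I_N] * ((K * L)%:R / L_min Psi L ^+ 2) + N%:R).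

(* Main.v *)
Require Import Defs.
From HB Require Import structures.
From mathcomp Require Import all_boot all_order all_algebra.
From mathcomp Require Import reals.
From mathcomp Require Import ring lra.

Set Implicit Arguments.
Unset Strict Implicit.
Unset Printing Implicit Defensive.

Import Order.TTheory GRing.Theory Num.Theory.
Local Open Scope ring_scope.

(** Write [u_i] for the rows of [Psi], [T(A)] for the frame matrix of the rows
    in [A], and [<A, B>] for the sum of the [<u_i, u_j>^2] over [i] in [A] and
    [j] in [B].  Expanding the squares shows that [<A, B>] is the Frobenius
    product of [T(A)] and [T(B)] ([cross_potentialE]).  Hence
    [F A = <A, A>], and the score [d_n] of the algorithm is [<{n}, all>], so
    that the algorithm minimizes the linear form [<A, all>] over the sets [A]
    with [L] elements.

    The theorem combines three estimates.
    - Nonnegativity of all terms gives [F L' <= <L', all>].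
    - The output [L'] has the [L] smallest scores, so [<L', all>] is at most
      [<L*, all>] and at most [L / N] times the total score [F all]
      (both instances of [card_sum_le]).
    - The square [|N T(L* ) - L T(all)|^2 >= 0] of the Frobenius norm gives
      [N^2 F L* + L^2 F all >= 2 N L <L*, all>].
    Together they yield [(N + L) F L' <= L F all + N F L*]
    ([ffw_output_bound]), which has the shape of the claim.  The
    factor [K / L_min^2] then appears because [F L* >= L_min^2 / K]: the trace
    of [T(L* )] is the energy of the selected rows, and Cauchy-Schwarz compares
    it with the Frobenius norm ([row_energy_sqr_le]).  If [L_min] vanishes, some
    admissible set consists of zero rows, and minimality of the scores forces
    [F L' = 0]. *)

(** * Sums over finite sets *)

(** Double counting: summing [d i <= d j] over all pairs compares the averages
    of [d] on [P] and [Q], in a form that survives empty sets. *)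
Lemma card_sum_le (R : realDomainType) (I : finType) (P Q : {set I})
    (d : I -> R) :
  (forall i j, i \in P -> j \in Q -> d i <= d j) ->
  #|Q|%:R * \sum_(i in P) d i <= #|P|%:R * \sum_(j in Q) d j.
Proof.
move=> dPQ; rewrite !mulr_natl -!sumr_const exchange_big /=.
rewrite [leRHS]exchange_big /= [leRHS]exchange_big /=.
by apply: ler_sum => i iP; apply: ler_sum => j jQ; apply: dPQ.
Qed.

(** Only the symmetric difference matters, and there [card_sum_le] compares two
    sets of the same size. *)
Lemma sum_smallest_le (R : realDomainType) (I : finType) (A B : {set I})
    (d : I -> R) :
  #|A| = #|B| -> (forall i j, i \in A -> j \notin A -> d i <= d j) ->
  \sum_(i in A) d i <= \sum_(i in B) d i.
Proof.
move=> cAB dA.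
rewrite (big_setID B) /= [leRHS](big_setID A) /= setIC lerD2l.
have cD : #|A :\: B| = #|B :\: A| by rewrite !cardsD cAB setIC.
have := @card_sum_le R I (A :\: B) (B :\: A) d _; rewrite cD.
have [|] := posnP #|B :\: A|.
  move=> B0 _; move: (B0); rewrite -cD => /cards0_eq ->.
  by move: B0 => /cards0_eq ->; rewrite !big_set0.
move=> Bgt0; rewrite ler_pM2l ?ltr0n //; apply=> i j.
by rewrite !inE => /andP[_ iA] /andP[jA _]; apply: dA.
Qed.

Lemma sqr_sum_le (R : realDomainType) (n : nat) (a : 'I_n -> R) :
  (\sum_i a i) ^+ 2 <= n%:R * \sum_i a i ^+ 2.
Proof.
case: n a => [|n] a; first by rewrite !big_ord0 expr0n mulr0.
set S := \sum_i a i; set Q := \sum_i a i ^+ 2; set m := _%:R : R.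
have m0 : 0 < m by rewrite ltr0n.
(* the variance of the family, scaled by its size *)
have : 0 <= \sum_i (m * a i - S) ^+ 2 by apply: sumr_ge0 => i _; apply: sqr_ge0.
have -> : \sum_i (m * a i - S) ^+ 2 = m * (m * Q - S ^+ 2).
  rewrite (eq_bigr (fun i => m ^+ 2 * a i ^+ 2 + (- (2 * m * S) * a i + S ^+ 2)));
    last by move=> i _; ring.
  rewrite !big_split /= -!mulr_sumr -/S -/Q sumr_const card_ord -mulr_natl -/m.
  ring.
by rewrite pmulr_rge0 // subr_ge0.
Qed.

(** * The frame potential as a bilinear form on sets of rows *)

Section CrossPotential.
Variables (R : realType) (N K : nat) (Psi : 'M[R]_(N, K)).
Implicit Types (A B : {set 'I_N}).

Definition gram_entry A (a b : 'I_K) : R := \sum_(i in A) Psi i a * Psi i b.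

Definition cross_potential A B : R :=
  \sum_(i in A) \sum_(j in B) (\sum_a Psi i a * Psi j a) ^+ 2.

Lemma cross_potential_ge0 A B : 0 <= cross_potential A B.
Proof. by do 2![apply: sumr_ge0 => ? _]; apply: sqr_ge0. Qed.

(** The Hadamard square of a Gram matrix is again a Gram matrix: the squared
    inner product of two rows is the Frobenius product of the rank-one
    matrices that they span. *)
Lemma cross_potentialE A B :
  cross_potential A B = \sum_a \sum_b gram_entry A a b * gram_entry B a b.
Proof.
transitivity (\sum_(i in A) \sum_(j in B) \sum_a \sum_b
    (Psi i a * Psi i b) * (Psi j a * Psi j b)).
  apply: eq_bigr => i _; apply: eq_bigr => j _; rewrite expr2 mulr_suml.
  apply: eq_bigr => a _; rewrite mulr_sumr; apply: eq_bigr => b _; ring.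
under eq_bigr do rewrite exchange_big /=.
rewrite exchange_big /=; apply: eq_bigr => a _.
under eq_bigr do rewrite exchange_big /=.
rewrite exchange_big /=; apply: eq_bigr => b _.
by rewrite /gram_entry mulr_suml; apply: eq_bigr => i _; rewrite mulr_sumr.
Qed.

Lemma frame_matrixE A a b :
  frame_matrix (row_submatrix Psi A) a b = gram_entry A a b.
Proof.
rewrite /frame_matrix mxE /gram_entry [RHS]big_enum_val /=.
by apply: eq_bigr => i _; rewrite !mxE.
Qed.

Lemma F_cross A : F Psi A = cross_potential A A.
Proof.
rewrite cross_potentialE /F /frame_potential /mxtrace exchange_big /=.
apply: eq_bigr => a _; rewrite mxE; apply: eq_bigr => b _.
by rewrite mxE !frame_matrixE.
Qed.

Lemma sum_ffw_d A : \sum_(n in A) ffw_d Psi n = cross_potential A [set: 'I_N].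
Proof.
rewrite cross_potentialE /ffw_d exchange_big /=.
apply: eq_bigr => a _; rewrite exchange_big /=; apply: eq_bigr => b _.
rewrite mulr_suml; apply: eq_bigr => n _.
have -> : ffw_m Psi a b = gram_entry [set: 'I_N] a b.
  rewrite /ffw_m /gram_entry mxE big_mkcond [RHS]big_mkcond /=.
  by apply: eq_bigr => i _; rewrite !mxE in_setT.
ring.
Qed.

Lemma F_le_cross A : F Psi A <= cross_potential A [set: 'I_N].
Proof.
rewrite F_cross; apply: ler_sum => i _.
rewrite [leRHS](big_setID A) /= setTI lerDl.
by apply: sumr_ge0 => j _; apply: sqr_ge0.
Qed.

(** Nonnegativity of the squared Frobenius norm of [y T(A) - x T(B)]. *)
Lemma cross_potential_AMGM (x y : R) A B :
  2 * x * y * cross_potential A B <= y ^+ 2 * F Psi A + x ^+ 2 * F Psi B.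
Proof.
rewrite !F_cross !cross_potentialE !mulr_sumr -big_split /=.
apply: ler_sum => a _; rewrite !mulr_sumr -big_split /=.
apply: ler_sum => b _; set p := gram_entry A a b; set q := gram_entry B a b.
rewrite -subr_ge0.
have -> : y ^+ 2 * (p * p) + x ^+ 2 * (q * q) - 2 * x * y * (p * q)
  = (y * p - x * q) ^+ 2 by ring.
exact: sqr_ge0.
Qed.

(** * Energy of the rows *)

Lemma row_energyE A : row_energy Psi A = \sum_a gram_entry A a a.
Proof.
rewrite /row_energy /gram_entry exchange_big /=; apply: eq_bigr => i _.
rewrite /norm2 sqr_sqrtr; last by apply: sumr_ge0 => a _; apply: sqr_ge0.
by apply: eq_bigr => a _; rewrite mxE expr2.
Qed.

(** The classical lower bound for the frame potential: a positive semidefinite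
    matrix of size [K] with given trace has smallest Frobenius norm when it is
    scalar. *)
Lemma row_energy_sqr_le A : row_energy Psi A ^+ 2 <= K%:R * F Psi A.
Proof.
rewrite row_energyE F_cross cross_potentialE.
apply: le_trans (sqr_sum_le _) _; apply: ler_wpM2l => //.
apply: ler_sum => a _; rewrite (bigD1 a) //= -expr2 lerDl.
by apply: sumr_ge0 => b _; rewrite -expr2 sqr_ge0.
Qed.

Lemma row_energy_ge0 A : 0 <= row_energy Psi A.
Proof. by apply: sumr_ge0 => i _; apply: sqr_ge0. Qed.

Lemma cross_potential_energy0 A B :
  row_energy Psi A = 0 -> cross_potential A B = 0.
Proof.
move=> A0; rewrite /cross_potential big1 // => i iA.
have := psumr_eq0P (fun j _ => sqr_ge0 _) A0 iA.
rewrite /norm2 sqr_sqrtr; last by apply: sumr_ge0 => a _; apply: sqr_ge0.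
move=> ui0; rewrite big1 // => j _; rewrite big1 ?expr0n // => a _.
have /eqP : row i Psi 0 a ^+ 2 = 0.
  by apply: (psumr_eq0P _ ui0) => // b _; apply: sqr_ge0.
by rewrite mxE sqrf_eq0 => /eqP ->; rewrite mul0r.
Qed.

Lemma L_min_ge0 L : 0 <= L_min Psi L.
Proof. by apply/le_bigmin => *; apply: row_energy_ge0. Qed.

Lemma L_min_le A : L_min Psi #|A| <= row_energy Psi A.
Proof. exact: bigmin_le_cond. Qed.

Lemma L_min_attained L A : #|A| = L ->
  exists2 B : {set 'I_N}, #|B| = L & row_energy Psi B = L_min Psi L.
Proof.
move=> /eqP cA; rewrite /L_min (@bigmin_eq_arg _ _ _ _ A) //.
  by case: arg_minP => // B /eqP cB _; exists B.
(* the total energy, the initial value of the minimum, bounds every candidate *)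
move=> B _; rewrite /row_energy [leRHS](big_setID B) /= setTI lerDl.
by apply: sumr_ge0 => i _; apply: sqr_ge0.
Qed.

(** * Selections with the smallest scores *)

Lemma ffw_output_cross_le L A B : ffw_output Psi L A -> #|B| = L ->
  cross_potential A [set: 'I_N] <= cross_potential B [set: 'I_N].
Proof.
by move=> [cA dA] cB; rewrite -!sum_ffw_d; apply: sum_smallest_le; rewrite ?cA.
Qed.

(** The [L] smallest scores have at most the average score. *)
Lemma ffw_output_average L A : ffw_output Psi L A ->
  N%:R * cross_potential A [set: 'I_N] <= L%:R * F Psi [set: 'I_N].
Proof.
move=> [cA dA].
have dAC i j : i \in A -> j \in ~: A -> ffw_d Psi i <= ffw_d Psi j.
  by rewrite inE; apply: dA.
have := card_sum_le dAC; rewrite cA F_cross -!sum_ffw_d.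
have -> : \sum_(n in [set: 'I_N]) ffw_d Psi n
    = \sum_(n in A) ffw_d Psi n + \sum_(n in ~: A) ffw_d Psi n.
  by rewrite (big_setID A) /= setTI setTD.
have -> : N%:R = L%:R + #|~: A|%:R :> R.
  by rewrite -natrD -cA cardsC card_ord.
lra.
Qed.

(** Apply [cross_potential_AMGM] with the weights [L] and [N], so that [T(B)]
    is compared with [L / N] times the full frame matrix, the value at the
    barycenter of all selections of [L] rows. *)
Lemma ffw_output_bound L A B : ffw_output Psi L A -> #|B| = L ->
  (N + L)%:R * F Psi A <= L%:R * F Psi [set: 'I_N] + N%:R * F Psi B.
Proof.
move=> hA cB.
have LN : (L <= N)%N by rewrite -cB -[X in (_ <= X)%N]card_ord max_card.
have [N0|N_gt0] := posnP N.
  have -> : L = 0%N by apply/eqP; rewrite -leqn0 -N0.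
  have n0 : N%:R = 0 :> R by rewrite N0.
  by rewrite addn0 n0 !mul0r addr0.
have n0 : 0 < N%:R :> R by rewrite ltr0n.
have l0 : 0 <= L%:R :> R by [].
have ln : L%:R <= N%:R :> R by rewrite ler_nat.
have avg := ffw_output_average hA.
have min := ffw_output_cross_le hA cB.
have amgm := cross_potential_AMGM L%:R N%:R B [set: 'I_N].
apply: (@le_trans _ _ ((N + L)%:R * cross_potential A [set: 'I_N])).
  by apply: ler_wpM2l => //; apply: F_le_cross.
move: avg min amgm.
set t := cross_potential A _; set w := cross_potential B _.
set s := F Psi _; set f := F Psi B; rewrite natrD.
set n := N%:R in n0 ln *; set l := L%:R in l0 ln * => avg min amgm.
rewrite -(ler_pM2l n0).
(* AM-GM and h2 bound n * (n f + l s) below by 2 n l t + l (n - l) s, and the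
   average bound h1 turns the last term into n (n - l) t *)
have h1 : (n - l) * (n * t) <= (n - l) * (l * s).
  by apply: ler_wpM2l; rewrite ?subr_ge0.
have h2 : l * n * t <= l * n * w.
  by apply: ler_wpM2l => //; apply: mulr_ge0 => //; apply: ltW.
lra.
Qed.

End CrossPotential.

(** * The approximation guarantee *)

Theorem theorem3 (R : realType) (N K L : nat) (Psi : 'M[R]_(N, K))
    (Lstar Lprime : {set 'I_N})
    (hKN : (K < N)%N)
    (hrank : \rank Psi = K)
    (hKL : (K <= L)%N)
    (hnonorth : ~ orthogonal_matrix Psi)
    (hsign : same_sign_rows Psi)
    (hstar : is_optimal_selection Psi L Lstar)
    (hprime : ffw_output Psi L Lprime) :
  F Psi Lprime <= gamma Psi L * F Psi Lstar.
Proof.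
have cS : #|Lstar| = L by case: hstar.
have F_ge0 A : 0 <= F Psi A by rewrite F_cross cross_potential_ge0.
have nl_gt0 : 0 < (N + L)%:R :> R by rewrite ltr0n addn_gt0 (leq_trans _ hKN).
have bound := ffw_output_bound hprime cS.
rewrite /gamma mul1r -mulrA ler_pdivlMl //.
have [m0|m_neq0] := eqVneq (L_min Psi L) 0.
  have [Z cZ Z0] := L_min_attained Psi cS; rewrite m0 in Z0.
  have := ffw_output_cross_le hprime cZ.
  rewrite (cross_potential_energy0 _ Z0) => /(le_trans (F_le_cross Psi _)) F0.
  apply: (@le_trans _ _ 0); first by rewrite pmulr_rle0.
  by rewrite m0 expr0n invr0 !mulr0 add0r mulr_ge0.
have m_gt0 : 0 < L_min Psi L by rewrite lt_def m_neq0 L_min_ge0.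
apply: (le_trans bound); rewrite mulrDl lerD2r -mulrA [leRHS]mulrC.
rewrite ler_wpM2r // mulrAC ler_pdivlMr ?exprn_gt0 //.
rewrite mulnC natrM -mulrA ler_wpM2l //.
apply: le_trans (row_energy_sqr_le _ _).
by rewrite ler_pXn2r ?nnegrE ?row_energy_ge0 ?L_min_ge0 // -cS L_min_le.
Qed.
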